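(* Let $k(x,y)=e^{-\sigma\|x-y\|_2^2}$ be the Gaussian kernel on $\mathcal{X}=[0,1]^d$ with $\sigma>0$, let $P$ be a probability measure on $\mathcal{X}$ with density $p$ satisfying $0<\inf p\le\sup p<\infty$, and let $\varphi_1,\varphi_2,\dots$ be the eigenfunctions in the Mercer decomposition of $k$. Let $b>0$ be such that $\max_{x\in\mathcal{X}}|\varphi_\ell(x)|\le b\,\ell^2$ for all $\ell=1,2,\dots$, and let $s>3$. Then for every $f=\sum_{\ell=1}^\infty c_\ell\varphi_\ell\in L^2$ with $$\|f\|_s^2:=\sum_{\ell=1}^\infty\frac{c_\ell^2}{\ell^{-2s}}<\infty$$ it holds that $$\|f\|_\infty\le\frac{\pi}{\sqrt6}\,b\,\|f\|_s^{\frac3s}\cdot\|f\|_2^{1-\frac3s}.$$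
   Context: $L^2=L^2(\mathcal{X},P)$ with norm $\|\cdot\|_2$, and $\|\cdot\|_\infty$ is the uniform norm on $\mathcal{X}$. The $\varphi_\ell$ are the continuous, $L^2(\mathcal{X},P)$-orthonormal eigenfunctions, ordered by non-increasing eigenvalues $\mu_\ell$, of the operator $(L_kf)(y)=\int_{\mathcal{X}}k(z,y)f(z)p(z)\,dz$ on $L^2(\mathcal{X},P)$, so that $k(x,y)=\sum_{\ell\ge1}\mu_\ell\varphi_\ell(x)\varphi_\ell(y)$. *)

(* Defs.v *)
From HB Require Import structures.
From mathcomp Require Import all_boot all_order all_algebra.
From mathcomp Require Import all_classical all_reals all_analysis.

Set Implicit Arguments.
Unset Strict Implicit.
Unset Printing Implicit Defensive.

Import Order.TTheory GRing.Theory Num.Theory.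
Import numFieldNormedType.Exports.

Local Open Scope classical_set_scope.
Local Open Scope ring_scope.

(* Points of R^d, with the product of the Borel sigma-algebras of R. *)
Notation Rvec R d := (d.-tuple (measurableTypeR R)).

Section lebesgue_cons.
Context {R : realType} (n : nat).
Variable m : {sigma_finite_measure set (Rvec R n) -> \bar R}.

Definition tcons (z : measurableTypeR R * Rvec R n) : Rvec R n.+1 :=
  [tuple of z.1 :: z.2].

Lemma measurable_tcons : measurable_fun [set: measurableTypeR R * Rvec R n] tcons.
Proof. exact: measurable_cons. Qed.

Definition lebesgue_cons : set (Rvec R n.+1) -> \bar R :=
  pushforward (@lebesgue_measure R \x m)%E tcons.

Let lebesgue_cons0 : lebesgue_cons set0 = 0%E.
Proof. by rewrite /lebesgue_cons /pushforward preimage_set0 measure0. Qed.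

Let lebesgue_cons_ge0 A : (0 <= lebesgue_cons A)%E.
Proof. by rewrite /lebesgue_cons /pushforward measure_ge0. Qed.

Let lebesgue_cons_sigma_additive : semi_sigma_additive lebesgue_cons.
Proof.
move=> F mF tF mUF; rewrite /lebesgue_cons /pushforward preimage_bigcup.
have mpre A : measurable A -> measurable (tcons @^-1` A).
  by move=> mA; rewrite -[X in measurable X]setTI; exact: measurable_tcons.
apply: measure_semi_sigma_additive => [k||]; first exact: mpre.
  apply/trivIsetP => /= i j _ _ ij; rewrite -preimage_setI.
  by move/trivIsetP : tF => /(_ _ _ _ _ ij) ->//; rewrite preimage_set0.
by rewrite -preimage_bigcup; exact: mpre.
Qed.

HB.instance Definition _ := isMeasure.Build _ _ _ lebesgue_cons
  lebesgue_cons0 lebesgue_cons_ge0 lebesgue_cons_sigma_additive.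

Lemma lebesgue_cons_sigma_finite : sigma_finite setT lebesgue_cons.
Proof.
have /sigma_finiteP[F [FT ndF Foo]] := sigma_finiteT (@lebesgue_measure R).
have /sigma_finiteP[G [GT ndG Goo]] := sigma_finiteT m.
pose u (y : Rvec R n.+1) : measurableTypeR R * Rvec R n :=
  (thead y, [tuple of behead y]).
have tconsK z : u (tcons z) = z.
  by case: z => a b; rewrite /u /tcons theadE; congr pair; apply/val_inj.
have mu : measurable_fun setT u.
  by apply: measurable_fun_pair; [exact: measurable_tnth|exact: measurable_behead].
exists (fun k => u @^-1` (F k `*` G k)) => [|k].
  apply/esym; rewrite -subTset => y _.
  have [i _ Fi] : (\bigcup_k F k) (u y).1 by rewrite -FT.
  have [j _ Gj] : (\bigcup_k G k) (u y).2 by rewrite -GT.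
  exists (maxn i j) => //; split.
    by move: Fi; exact/subsetPset/ndF/leq_maxl.
  by move: Gj; exact/subsetPset/ndG/leq_maxr.
have [mF Flty] := Foo k; have [mG Glty] := Goo k; split.
  by rewrite -[X in measurable X]setTI; apply: mu => //; exact: measurableX.
rewrite /lebesgue_cons /pushforward -comp_preimage.
have -> : u \o tcons = id by apply/funext => z /=.
by rewrite preimage_id product_measure1E// lte_mul_pinfty// ge0_fin_numE.
Qed.

HB.instance Definition _ :=
  Measure_isSigmaFinite.Build _ _ _ lebesgue_cons lebesgue_cons_sigma_finite.

End lebesgue_cons.

(* Lebesgue measure on R^d: the d-fold product of lebesgue_measure. *)
Fixpoint lebesgue {R : realType} (d : nat) :
    {sigma_finite_measure set (Rvec R d) -> \bar R} :=
  match d with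
  | 0 => \d_([tuple] : Rvec R 0)
  | n.+1 => lebesgue_cons (lebesgue n)
  end.

Definition cube (R : realType) (d : nat) : set (Rvec R d) :=
  [set x | forall i, 0 <= tnth x i <= 1].
Arguments cube : clear implicits.

Definition euclidean_dist (R : realType) (d : nat) (x y : Rvec R d) : R :=
  Num.sqrt (\sum_(i < d) (tnth x i - tnth y i) ^+ 2).

Definition gaussian_kernel (R : realType) (d : nat) (sigma : R)
    (x y : Rvec R d) : R :=
  expR (- sigma * euclidean_dist x y ^+ 2).

(* The library topologizes row vectors, not tuples. *)
Definition tuple_of_row (R : realType) (d : nat) (v : 'rV[R]_d) : Rvec R d :=
  [tuple v ord0 i | i < d].

(* In everything below, a function on the cube X is a function on R^d whose
   values outside X are irrelevant. *)
Definition continuous_on_cube (R : realType) (d : nat) (f : Rvec R d -> R) :=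
  {within [set v : 'rV[R]_d | cube R d (tuple_of_row v)],
    continuous (fun v => f (tuple_of_row v))}.

Definition uniform_norm (R : realType) (d : nat) (f : Rvec R d -> R) : \bar R :=
  ereal_sup [set (`|f x|)%:E | x in cube R d].

(* P is carried by the cube, with density p there. *)
Definition has_density (R : realType) (d : nat) (P : probability (Rvec R d) R)
    (p : Rvec R d -> R) : Prop :=
  measurable_fun (cube R d) p /\
  forall A, measurable A ->
    P A = (\int[lebesgue d]_(x in A `&` cube R d) (p x)%:E)%E.

Definition inL2 (R : realType) (d : nat) (P : probability (Rvec R d) R)
    (f : Rvec R d -> R) : Prop :=
  f \_ (cube R d) \in Lfun P 2%:E.

Definition L2norm (R : realType) (d : nat) (P : probability (Rvec R d) R)
    (f : Rvec R d -> R) : \bar R :=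
  'N[P]_2%:E [EFin \o (f \_ (cube R d))].

Definition L2inner (R : realType) (d : nat) (P : probability (Rvec R d) R)
    (f g : Rvec R d -> R) : R :=
  \int[P]_(x in cube R d) (f x * g x).

Definition kernel_operator (R : realType) (d : nat)
    (k : Rvec R d -> Rvec R d -> R) (p f : Rvec R d -> R) (y : Rvec R d) : R :=
  \int[lebesgue d]_(z in cube R d) (k z y * f z * p z).

(* Sequences indexed by l = 1, 2, ... are functions on nat whose value at 0 is
   irrelevant. *)
Record mercer_decomposition (R : realType) (d : nat)
    (k : Rvec R d -> Rvec R d -> R) (P : probability (Rvec R d) R)
    (p : Rvec R d -> R) (mu : nat -> R) (phi : nat -> Rvec R d -> R) : Prop := {
  mercer_continuous : forall l, (0 < l)%N -> continuous_on_cube (phi l) ;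
  mercer_orthonormal : forall l m, (0 < l)%N -> (0 < m)%N ->
    L2inner P (phi l) (phi m) = (l == m)%:R ;
  mercer_eigen : forall l, (0 < l)%N ->
    {ae P, forall y, cube R d y ->
      kernel_operator k p (phi l) y = mu l * phi l y} ;
  mercer_nonincreasing : forall l m, (0 < l)%N -> (l <= m)%N -> mu m <= mu l ;
  mercer_expansion : forall x y, cube R d x -> cube R d y ->
    (fun n => \sum_(1 <= l < n.+1) mu l * phi l x * phi l y) @ \oo --> k x y
}.

Definition L2_expansion (R : realType) (d : nat) (P : probability (Rvec R d) R)
    (phi : nat -> Rvec R d -> R) (c : nat -> R) (f : Rvec R d -> R) : Prop :=
  (fun n => L2norm P (fun x => f x - \sum_(1 <= l < n.+1) c l * phi l x))
    @ \oo --> 0%E.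

Definition snorm2 (R : realType) (s : R) (c : nat -> R) : \bar R :=
  (\sum_(1 <= l <oo) (c l ^+ 2 / l%:R `^ (- 2 * s))%:E)%E.

Definition snorm (R : realType) (s : R) (c : nat -> R) : R :=
  Num.sqrt (fine (snorm2 s c)).

(* An element of L^2(X, P) is a function up to P-null sets, so its uniform norm
   is that of its continuous representative, which is unique when P charges
   every nonempty relatively open subset of the cube. *)
Definition continuous_representative (R : realType) (d : nat)
    (P : probability (Rvec R d) R) (f g : Rvec R d -> R) : Prop :=
  continuous_on_cube g /\ {ae P, forall x, cube R d x -> g x = f x}.

(* Main.v *)
Require Import Defs.
From HB Require Import structures.
From mathcomp Require Import all_boot all_order all_algebra.
From mathcomp Require Import all_classical all_reals all_analysis.
From mathcomp Require Import measurable_realfun ring lra.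

Import Order.TTheory GRing.Theory Num.Theory.
Import numFieldNormedType.Exports.

Local Open Scope classical_set_scope.
Local Open Scope ring_scope.

(** Write c_l l^2 = (c_l l^3) * l^-1. Cauchy-Schwarz and the Basel sum bound
    \sum_l |c_l| l^2 by pi / sqrt 6 times (\sum_l c_l^2 l^6)^(1/2), and Hoelder's
    inequality with exponents s/3 and s/(s-3) interpolates the latter sum between
    \sum_l c_l^2 l^(2s) and \sum_l c_l^2, which Bessel's inequality bounds by the
    squared L^2 norm of f. Hence the expansion of f converges uniformly on the cube
    and its sum is a continuous representative of f obeying the bound. The bound
    passes to every continuous representative because a density bounded away from 0
    makes P charge every nonempty relatively open subset of the cube. *)

(** * The Basel sum and the interpolation inequality *)

Lemma sin_le_id {R : realType} (x : R) : 0 <= x -> sin x <= x.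
Proof.
rewrite le_eqVlt => /predU1P[<-|x0]; first by rewrite sin0.
have dsin y : is_derive y (1 : R) sin (cos y) by exact: is_derive_sin.
have csin : {within `[0, x], continuous (sin : R -> R)}.
  by apply: continuous_subspaceT; exact: continuous_sin.
have [y _] := MVT x0 (fun y _ => dsin y) csin.
rewrite sin0 !subr0 => ->.
by rewrite -[leRHS]mul1r ler_wpM2r ?cos_le1// ltW.
Qed.

(** With S and C the sine and cosine of [x / 2], the left side is 1/S^2 + 1/C^2 = 1/(S C)^2, and
    [sin x] = 2 S C. *)
Lemma invr_sqr_sin_half {R : realType} (x : R) : 0 < x < pi / 2 ->
  (sin (x / 2) ^+ 2)^-1 + (sin (pi / 2 - x / 2) ^+ 2)^-1 =
  4 * (sin x ^+ 2)^-1.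
Proof.
move=> /andP[x0 xpi].
have -> : sin (pi / 2 - x / 2) = cos (x / 2).
  by rewrite addrC sinDpihalf cosN.
have -> : sin x = 2 * (cos (x / 2) * sin (x / 2)).
  by rewrite mulr_natl -sin_mulr2n; congr sin; rewrite -mulr_natr; lra.
have s0 : sin (x / 2) != 0 by rewrite gt_eqF// sin_gt0_pihalf//; apply/andP; split; lra.
have c0 : cos (x / 2) != 0 by rewrite gt_eqF// cos_gt0_pihalf//; apply/andP; split; lra.
have := cos2Dsin2 (x / 2).
move: s0 c0; set S := sin _; set C := cos _ => s0 c0 e.
have -> : (S ^+ 2)^-1 + (C ^+ 2)^-1 = (C ^+ 2 + S ^+ 2) / (S ^+ 2 * C ^+ 2).
  by field; rewrite s0 c0.
by rewrite e; field; rewrite s0 c0.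
Qed.

(* Halving each angle of the grid for n, by invr_sqr_sin_half, gives the grid for
   n + 1: x / 2 keeps the index k, pi / 2 - x / 2 has index 2^(n+1) - 1 - k. *)
Lemma sum_invr_sqr_sin {R : realType} (n : nat) :
  \sum_(0 <= k < 2 ^ n)
    (sin ((2 * k%:R + 1) * (pi / (4 * 2 ^+ n))) ^+ 2)^-1 = 2 * 4 ^+ n :> R.
Proof.
elim: n => [|n IH].
  rewrite expn0 big_nat1 mulr0 add0r mul1r !expr0 !mulr1.
  have s0 : 0 < sin (pi / 4 : R).
    by apply: sin_gt0_pihalf; have := pi_gt0 R => pi0; apply/andP; split; lra.
  have c0 : 0 < cos (pi / 4 : R).
    by apply: cos_gt0_pihalf; have := pi_gt0 R => pi0; apply/andP; split; lra.
  have t : cos (pi / 4 : R) = sin (pi / 4).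
    by rewrite -cosBpihalf -cosN; congr cos; lra.
  have := cos2Dsin2 (pi / 4 : R); rewrite t => e.
  have -> : sin (pi / 4 : R) ^+ 2 = 2^-1 by lra.
  by rewrite invrK.
rewrite [4 ^+ _]exprS mulrCA -IH expnS mul2n -addnn.
(* Cut at the midpoint and reverse the upper half, so that the two angles arising from one index [k]
   share a summand. *)
rewrite (@big_cat_nat _ _ _ (2 ^ n))//= ?leq_addr//.
rewrite -{2}[(2 ^ n)%N]add0n big_addn addnK.
rewrite [X in _ + X]big_nat_rev/= -big_split mulr_sumr !big_nat; apply: eq_bigr => k /=.
move=> kn; have N0 : (0 : R) < 2 ^+ n by rewrite exprn_gt0.
have kN : k%:R + 1 <= (2 ^+ n : R).
  by rewrite -natrX natr1 ler_nat.
have k0 : 0 <= k%:R :> R by [].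
rewrite -invr_sqr_sin_half.
  congr ((sin _ ^+ 2)^-1 + (sin _ ^+ 2)^-1).
    by rewrite exprS; field; rewrite gt_eqF.
  rewrite add0n natrD natrB// natrX exprS -[k.+1%:R]natr1.
  by field; rewrite gt_eqF.
have pi0 := pi_gt0 R.
apply/andP; split.
  by apply: mulr_gt0; [lra|apply: divr_gt0; lra].
rewrite mulrA ltr_pdivrMr; last lra.
rewrite [ltLHS]mulrC -mulrA ltr_pM2l//.
lra.
Qed.

(** As [sin x <= x] for x >= 0, each 1/(2k+1)^2 is at most a^2 / sin^2((2k+1)a). For a = pi/(4 2^n)
    the sine sum is known, and a^2 times 2 4^n is pi^2/8. *)
Lemma sum_invr_sqr_odd {R : realType} (n : nat) :
  \sum_(0 <= k < n) ((2 * k%:R + 1) ^+ 2)^-1 <= pi ^+ 2 / 8 :> R.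
Proof.
(* The sine identity concerns 2^n terms, so the sum is first extended from n to 2^n terms. *)
apply: (@le_trans _ _ (\sum_(0 <= k < 2 ^ n) ((2 * k%:R + 1) ^+ 2)^-1)).
  rewrite [leRHS](@big_cat_nat _ _ _ n)//=; last exact/ltnW/ltn_expl.
  by rewrite lerDl sumr_ge0// => k _; rewrite invr_ge0 sqr_ge0.
have pi0 := pi_gt0 R.
have N0 : (0 : R) < 2 ^+ n by rewrite exprn_gt0.
set a : R := pi / (4 * 2 ^+ n).
have a0 : 0 < a by rewrite divr_gt0// mulr_gt0.
have <- : a ^+ 2 * (2 * 4 ^+ n) = pi ^+ 2 / 8.
  have -> : 4 ^+ n = (2 ^+ n) ^+ 2 :> R by rewrite exprAC; congr (_ ^+ n); lra.
  by rewrite /a; field; rewrite gt_eqF.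
rewrite -sum_invr_sqr_sin mulr_sumr !big_nat; apply: ler_sum => k /= kn.
have k0 : 0 <= k%:R :> R by [].
have kN : k%:R + 1 <= (2 ^+ n : R).
  by rewrite -natrX natr1 ler_nat.
rewrite -/a; set u := 2 * k%:R + 1.
have u0 : 0 < u by rewrite /u; lra.
have s0 : 0 < sin (u * a).
  apply: sin_gt0_pi; rewrite mulr_gt0//= /a mulrA ltr_pdivrMr; last lra.
  by rewrite mulrC ltr_pM2l// /u; lra.
rewrite ler_pdivlMr ?exprn_gt0// mulrC ler_pdivrMr ?exprn_gt0//.
have ua0 : 0 <= u * a by rewrite mulr_ge0 ?ltW.
by rewrite -exprMn [a * u]mulrC ler_pXn2r ?nnegrE ?sin_le_id// ltW.
Qed.

(** Separating odd and even l gives S(2n) = odd part + S(n)/4. With S(n) <= S(2n) this leaves (3/4)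
    S(n) <= pi^2/8. *)
Lemma sum_invr_sqr_le {R : realType} (n : nat) :
  \sum_(1 <= l < n.+1) (l%:R ^+ 2)^-1 <= pi ^+ 2 / 6 :> R.
Proof.
set S := fun n => \sum_(1 <= l < n.+1) (l%:R ^+ 2)^-1 : R.
have double m : S m.*2 = \sum_(0 <= k < m) ((2 * k%:R + 1) ^+ 2)^-1 + S m / 4.
  elim: m => [|m IH]; first by rewrite /S !big_geq// mul0r addr0.
  rewrite doubleS /S big_nat_recr//= big_nat_recr//= -/(S _) IH.
  rewrite [in RHS]big_nat_recr//= [in RHS]big_nat_recr//= -/(S _).
  have -> : (m.*2.+2%:R : R) = 2 * m.+1%:R by rewrite -doubleS -mul2n natrM.
  have -> : (m.*2.+1%:R : R) = 2 * m%:R + 1 by rewrite -natr1 -mul2n natrM.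
  rewrite exprMn [(2 ^+ 2 * _)^-1]invfM.
  by move: (_ ^- 2) (m.+1%:R ^- 2) => x y; lra.
have : S n <= S n.*2.
  rewrite /S [leRHS](@big_cat_nat _ _ _ n.+1)//=; last by rewrite ltnS -addnn leq_addr.
  by rewrite lerDl sumr_ge0// => k _; rewrite invr_ge0 sqr_ge0.
rewrite double; have := @sum_invr_sqr_odd R n; rewrite -/(S n).
by move: (S n) (\sum_(0 <= k < n) _) => x y; lra.
Qed.

(** Young's inequality for the conjugate exponents 1/t and 1/(1-t). *)
Lemma weighted_AMGM {R : realType} (t a b : R) : 0 < t < 1 -> 0 <= a -> 0 <= b ->
  a `^ t * b `^ (1 - t) <= t * a + (1 - t) * b.
Proof.
move=> /andP[t0 t1] a0 b0; have t1' : 0 < 1 - t by rewrite subr_gt0.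
have := @conjugate_powR R (a `^ t) (b `^ (1 - t)) t^-1 (1 - t)^-1.
rewrite !powR_ge0 !invr_gt0 !invrK t0 t1' -!powRrM !divff ?gt_eqF//.
by rewrite !powRr1// addrC subrK [t * _]mulrC [(1 - t) * _]mulrC; exact.
Qed.

Lemma powRV {R : realType} (x r : R) : 0 <= x -> x^-1 `^ r = (x `^ r)^-1.
Proof. by move=> x0; rewrite -powR_inv1// -powRrM mulN1r powRN. Qed.

(** Hoelder's inequality: once both families are divided by their sums, weighted AM-GM applies term
    by term, and the bounds add up to t + (1 - t) = 1. *)
Lemma sum_powR_le {R : realType} (t : R) (I : Type) (r : seq I) (a b : I -> R) :
  0 < t < 1 -> (forall i, 0 <= a i) -> (forall i, 0 <= b i) ->
  \sum_(i <- r) a i `^ t * b i `^ (1 - t) <=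
    (\sum_(i <- r) a i) `^ t * (\sum_(i <- r) b i) `^ (1 - t).
Proof.
move=> t01 a0 b0; have /andP[t0 t1] := t01.
have t1' : 0 < 1 - t by rewrite subr_gt0.
(* The normalisation divides by the sums, so a zero sum is treated apart: every term is then 0, and
   so is its positive power. *)
have zero (u v : I -> R) (x : R) : 0 < x -> (forall i, 0 <= u i) ->
    \sum_(i <- r) u i = 0 -> \sum_(i <- r) u i `^ x * v i = 0.
  move=> x0 u0 ur; elim: r ur => [|i q IH]; first by rewrite !big_nil.
  rewrite !big_cons => /eqP; rewrite paddr_eq0 ?sumr_ge0// => /andP[/eqP -> /eqP/IH ->].
  by rewrite powR0 ?gt_eqF// mul0r addr0.
set A := \sum_(i <- r) a i; set B := \sum_(i <- r) b i.
have A0 : 0 <= A by rewrite sumr_ge0.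
have B0 : 0 <= B by rewrite sumr_ge0.
have [A00|AN0] := eqVneq A 0.
  by rewrite zero// mulr_ge0 ?powR_ge0.
have [B00|BN0] := eqVneq B 0.
  under eq_bigr do rewrite mulrC.
  by rewrite zero// mulr_ge0 ?powR_ge0.
have Ap : 0 < A by rewrite lt_neqAle eq_sym AN0.
have Bp : 0 < B by rewrite lt_neqAle eq_sym BN0.
set C := _ * _; have C0 : 0 < C by rewrite mulr_gt0 ?powR_gt0.
rewrite -[leRHS]mul1r -ler_pdivrMr// mulr_suml.
apply: (@le_trans _ _ (\sum_(i <- r) (t * (a i / A) + (1 - t) * (b i / B)))).
  apply: ler_sum => i _.
  have := @weighted_AMGM R t (a i / A) (b i / B) t01.
  rewrite !divr_ge0// => /(_ isT isT); rewrite !powRM ?invr_ge0//.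
  by rewrite !powRV// /C invfM mulrACA.
rewrite big_split/= -!mulr_sumr -!mulr_suml -/A -/B !divff//.
by lra.
Qed.

(** [A] and [F ^+ 2] only bound partial sums; the resulting bound does not depend on [n] and can
    serve as the constant of the M-test. *)
Lemma sum_norm_coef_sqr_le {R : realType} (s A F : R) (c : nat -> R) (n : nat) :
  3 < s -> 0 <= F ->
  \sum_(1 <= l < n.+1) c l ^+ 2 / l%:R `^ (- 2 * s) <= A ->
  \sum_(1 <= l < n.+1) c l ^+ 2 <= F ^+ 2 ->
  \sum_(1 <= l < n.+1) `|c l| * l%:R ^+ 2 <=
    pi / Num.sqrt 6 * Num.sqrt A `^ (3 / s) * F `^ (1 - 3 / s).
Proof.
move=> s3 F0 hA hF; set t := 3 / s.
have s0 : 0 < s by lra.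
have t0 : 0 < t by rewrite divr_gt0.
have t1 : t < 1 by rewrite ltr_pdivrMr// mul1r.
have t01 : 0 < t < 1 by rewrite t0.
have A0 : 0 <= A.
  by apply: le_trans hA; rewrite sumr_ge0// => l _; rewrite divr_ge0 ?sqr_ge0 ?powR_ge0.
(* Hoelder with t = 3/s, the choice for which the weight l^(2s) raised to the power t is l^6. *)
have hM : \sum_(1 <= l < n.+1) c l ^+ 2 * l%:R ^+ 6 <= A `^ t * (F ^+ 2) `^ (1 - t).
  rewrite (eq_big_nat _ _ (F2 := fun l : nat =>
    (c l ^+ 2 / l%:R `^ (- 2 * s)) `^ t * (c l ^+ 2) `^ (1 - t))); last first.
    move=> l /andP[l0 _]; have lR : 0 < l%:R :> R by rewrite ltr0n.
    rewrite powRM ?sqr_ge0 ?invr_ge0 ?powR_ge0// powRV ?powR_ge0// -powRrM -powRN.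
    have -> : - (- 2 * s * t) = 6%:R by rewrite /t; field; rewrite gt_eqF.
    rewrite powR_mulrn ?ltW// [RHS]mulrAC -powRD ?subrKC ?powRr1 ?sqr_ge0//.
    by rewrite oner_eq0.
  apply: le_trans (sum_powR_le _ _ _ _ _ t01 _ _) _.
  - by move=> l; rewrite divr_ge0 ?sqr_ge0 ?powR_ge0.
  - by move=> l; exact: sqr_ge0.
  have sc0 : 0 <= \sum_(1 <= l < n.+1) c l ^+ 2.
    by rewrite sumr_ge0// => l _; exact: sqr_ge0.
  have sA0 : 0 <= \sum_(1 <= l < n.+1) c l ^+ 2 / l%:R `^ (- 2 * s).
    by rewrite sumr_ge0// => l _; rewrite divr_ge0 ?sqr_ge0 ?powR_ge0.
  by apply: ler_pM; rewrite ?powR_ge0// ge0_ler_powR ?nnegrE ?sqr_ge0// ?subr_ge0 ltW.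
have h01 : 0 < (2^-1 : R) < 1 by rewrite invr_gt0 ltr0n/= invf_lt1// ltr1n.
have half : 1 - 2^-1 = 2^-1 :> R by lra.
(* Cauchy-Schwarz as the case t = 1/2 of [sum_powR_le], since |c_l| l^2 = (c_l^2 l^6)^(1/2)
   (l^-2)^(1/2). *)
rewrite (eq_big_nat _ _ (F2 := fun l : nat =>
  (c l ^+ 2 * l%:R ^+ 6) `^ 2^-1 * (l%:R ^- 2) `^ (1 - 2^-1))); last first.
  move=> l /andP[l0 _]; have lR : 0 < l%:R :> R by rewrite ltr0n.
  have cl0 : 0 <= c l ^+ 2 * l%:R ^+ 6 by rewrite mulr_ge0 ?sqr_ge0 ?exprn_ge0.
  have l20 : 0 <= l%:R ^- 2 :> R by rewrite invr_ge0 sqr_ge0.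
  rewrite half !powR12_sqrt//.
  rewrite (exprM _ 3 2) -exprMn sqrtrV ?sqr_ge0// !sqrtr_sqr normrM.
  rewrite [`|_ ^+ 3|]ger0_norm ?exprn_ge0// [`|l%:R|]ger0_norm//.
  by field; rewrite gt_eqF.
apply: le_trans (sum_powR_le _ _ _ _ _ h01 _ _) _.
- by move=> l; rewrite mulr_ge0 ?sqr_ge0 ?exprn_ge0.
- by move=> l; rewrite invr_ge0 sqr_ge0.
have sM0 : 0 <= \sum_(1 <= l < n.+1) c l ^+ 2 * l%:R ^+ 6.
  by rewrite sumr_ge0// => l _; rewrite mulr_ge0 ?sqr_ge0 ?exprn_ge0.
have sB0 : 0 <= \sum_(1 <= l < n.+1) (l%:R : R) ^- 2.
  by rewrite sumr_ge0// => l _; rewrite invr_ge0 sqr_ge0.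
(* As a product of two square roots, the target separates into the Hoelder bound and the Basel
   bound. *)
have -> : pi / Num.sqrt 6 * Num.sqrt A `^ t * F `^ (1 - t) =
    Num.sqrt (A `^ t * (F ^+ 2) `^ (1 - t)) * Num.sqrt (pi ^+ 2 / 6) :> R.
  rewrite [Num.sqrt (pi ^+ 2 / 6)]sqrtrM ?sqr_ge0// sqrtrM ?powR_ge0// sqrtrV//.
  rewrite sqrtr_sqr ger0_norm ?pi_ge0//.
  rewrite -[Num.sqrt (A `^ t)]powR12_sqrt ?powR_ge0// powRAC powR12_sqrt//.
  rewrite -[Num.sqrt (_ `^ (1 - t))]powR12_sqrt ?powR_ge0// powRAC.
  by rewrite powR12_sqrt ?sqr_ge0// sqrtr_sqr ger0_norm//; lra.
rewrite half !powR12_sqrt// ler_pM ?sqrtr_ge0// ler_wsqrtr//.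
exact: sum_invr_sqr_le.
Qed.

(** * Continuous functions on the cube *)

Definition row_of_tuple {R : realType} {d} (x : Rvec R d) : 'rV[R]_d :=
  \row_i tnth x i.

Lemma row_of_tupleK {R : realType} {d} : cancel (@row_of_tuple R d) (@tuple_of_row R d).
Proof. by move=> x; apply: eq_from_tnth => i; rewrite tnth_mktuple mxE. Qed.

(** Balls of row vectors are coordinatewise boxes, so the condition can be read directly on tuples,
    where the measures live. *)
Lemma continuous_on_cubeP {R : realType} {d} (f : Rvec R d -> R) :
  continuous_on_cube f <->
  forall x, cube R d x -> forall e, 0 < e -> exists2 r, 0 < r &
    forall y, cube R d y -> (forall i, `|tnth x i - tnth y i| < r) ->
      `|f x - f y| < e.
Proof.
split=> [/subspace_continuousP cf x cx e e0|cf].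
  have cx' : cube R d (tuple_of_row (row_of_tuple x)) by rewrite row_of_tupleK.
  have /cvgrPdist_lt/(_ e e0) := cf _ cx'.
  rewrite near_withinE => /nbhs_ballP[r /= r0 rf].
  exists r => // y cy xy; have := rf (row_of_tuple y).
  rewrite /from_subspace !row_of_tupleK; apply => //; split=> // i j.
  by rewrite /ball/= !mxE.
apply/subspace_continuousP => v cv; apply/cvgrPdist_lt => e e0.
rewrite near_withinE; have [r r0 rf] := cf _ cv _ e0.
apply/nbhs_ballP; exists r => //= w [_ vw] cw; apply: rf => // i.
by rewrite !tnth_mktuple; exact: vw.
Qed.

Lemma continuous_on_cube_series {R : realType} {d} (phi : nat -> Rvec R d -> R)
    (c : nat -> R) (n : nat) :
  (forall l, (0 < l)%N -> continuous_on_cube (phi l)) ->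
  continuous_on_cube (fun x => \sum_(1 <= l < n.+1) c l * phi l x).
Proof.
move=> cphi; apply/subspace_continuousP => v cv. rewrite /from_subspace.
elim: n => [|n IH].
  under eq_fun do rewrite big_geq//; rewrite big_geq//; exact: cvg_cst.
under eq_fun do rewrite big_nat_recr//=; rewrite big_nat_recr//=.
apply: cvgD; first exact: IH.
apply: cvgM; first exact: cvg_cst.
by have /subspace_continuousP := cphi n.+1 isT; exact.
Qed.

(** The three-epsilon argument, with [t] as the rate of uniform convergence. *)
Lemma continuous_on_cube_uniform_limit {R : realType} {d}
    (u : nat -> Rvec R d -> R) (g : Rvec R d -> R) (t : nat -> R) :
  (forall n, continuous_on_cube (u n)) -> t @ \oo --> 0 ->
  (forall n x, cube R d x -> `|g x - u n x| <= t n) -> continuous_on_cube g.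
Proof.
move=> cu t0 ut; apply/continuous_on_cubeP => x cx e e0.
have e3 : 0 < e / 3 by rewrite divr_gt0.
have /cvgr0Pnorm_lt/(_ _ e3)[n _ /(_ n (leqnn n)) tn] := t0.
have {}tn : t n < e / 3 by exact: le_lt_trans (ler_norm _) tn.
have /continuous_on_cubeP/(_ x cx _ e3)[r r0 ru] := cu n.
exists r => // y cy xy; have := ru y cy xy; have := ut n x cx; have := ut n y cy.
rewrite !ler_norml !ltr_norml => /andP[? ?] /andP[? ?] /andP[? ?].
by apply/andP; split; lra.
Qed.

Lemma measurable_box {R : realType} {d} (B : 'I_d -> set (measurableTypeR R)) :
  (forall i, measurable (B i)) ->
  measurable [set x : Rvec R d | forall i, B i (tnth x i)].
Proof.
move=> mB; rewrite [X in measurable X](_ : _ =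
    \bigcap_(i in [set: 'I_d]) ((fun x : Rvec R d => tnth x i) @^-1` B i)).
  apply: fin_bigcap_measurable => // i _; rewrite -[X in measurable X]setTI.
  exact: measurable_tnth.
by apply/seteqP; split=> [x Bx i _|x Bx i]; exact: Bx.
Qed.

Lemma measurable_cube {R : realType} {d} : measurable (cube R d).
Proof.
apply: (@measurable_box R d (fun=> [set` `[0, 1]])) => i.
exact: measurable_itv.
Qed.

(* f \o grid_floor n is constant on each box of a countable grid, and converges
   pointwise to f on the cube when f is continuous there. *)
Definition grid_floor {R : realType} {d} (n : nat) (x : Rvec R d) : Rvec R d :=
  [tuple (Num.floor (tnth x i * n.+1%:R))%:~R / n.+1%:R | i < d].

Lemma grid_floor_cube {R : realType} {d} n (x : Rvec R d) :
  cube R d x -> cube R d (grid_floor n x).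
Proof.
move=> cx i; rewrite tnth_mktuple; have /andP[x0 x1] := cx i.
rewrite divr_ge0 ?ler0z ?floor_ge0 ?mulr_ge0//= ler_pdivrMr// mul1r.
by rewrite (le_trans (floor_le_tmp _))// -[leRHS]mul1r ler_wpM2r.
Qed.

Lemma grid_floor_dist {R : realType} {d} n (x : Rvec R d) i :
  `|tnth x i - tnth (grid_floor n x) i| <= n.+1%:R^-1.
Proof.
rewrite tnth_mktuple; set y := tnth x i.
have -> : y - (Num.floor (y * n.+1%:R))%:~R / n.+1%:R =
    (y * n.+1%:R - (Num.floor (y * n.+1%:R))%:~R) / n.+1%:R.
  by field; rewrite addrC natr1.
have := floor_itv (y * n.+1%:R); rewrite intrD => /andP[h1 h2].
rewrite ger0_norm ?divr_ge0 ?subr_ge0// ler_pdivrMr// mulVf//.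
by lra.
Qed.

(** The preimage of [B] is the union, over the countably many integer tuples [t] with [f (g t)] in
    [B], of the half-open grid cells indexed by [t]. *)
Lemma measurable_comp_grid_floor {R : realType} {d} n (f : Rvec R d -> R) :
  measurable_fun setT (fun x => f (grid_floor n x) : measurableTypeR R).
Proof.
move=> _ B mB; rewrite setTI.
pose g (t : d.-tuple int) : Rvec R d := [tuple (tnth t i)%:~R / n.+1%:R | i < d].
rewrite [X in measurable X](_ : _ = \bigcup_(t : d.-tuple int)
    ([set x | B (f (g t)) /\
      forall i, Num.floor (tnth x i * n.+1%:R) = tnth t i])); last first.
  apply/seteqP; split=> x /=.
    move=> Bx; exists [tuple Num.floor (tnth x i * n.+1%:R) | i < d] => //=.
    split; last by move=> i; rewrite tnth_mktuple.
    suff -> : g [tuple Num.floor (tnth x i * n.+1%:R) | i < d] = grid_floor n x by [].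
    by apply: eq_from_tnth => i; rewrite !tnth_mktuple.
  move=> [t _ [Bt xt]]; suff -> : grid_floor n x = g t by [].
  by apply: eq_from_tnth => i; rewrite !tnth_mktuple xt.
apply: countable_bigcupT_measurable; first exact: countableP.
move=> t; have [Bt|nBt] := pselect (B (f (g t))); last first.
  by rewrite (_ : [set _ | _] = set0)//; apply/seteqP; split => // x [].
rewrite (_ : [set _ | _] = [set x : Rvec R d | forall i,
    [set y : R | Num.floor (y * n.+1%:R) = tnth t i] (tnth x i)]); last first.
  by apply/seteqP; split => [x []//|x xt]; split.
apply: (@measurable_box R d
  (fun i => [set y : R | Num.floor (y * n.+1%:R) = tnth t i])) => i.
rewrite (_ : [set _ | _] =
    [set` `[(tnth t i)%:~R / n.+1%:R, (tnth t i + 1)%:~R / n.+1%:R[]).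
  exact: measurable_itv.
apply/seteqP; split=> y /=; rewrite in_itv/= ler_pdivrMr// ltr_pdivlMr//.
  by move=> <-; exact: floor_itv.
by move=> h; apply: floor_def.
Qed.

(** A pointwise limit of the functions [f \o grid_floor n] on the cube. This avoids comparing the
    topology of row vectors with the product sigma-algebra on tuples. *)
Lemma measurable_continuous_on_cube {R : realType} {d} (f : Rvec R d -> R) :
  continuous_on_cube f ->
  measurable_fun setT (f \_ (cube R d) : Rvec R d -> measurableTypeR R).
Proof.
move=> /continuous_on_cubeP cf.
apply/(measurable_restrictT f measurable_cube).
apply: (@measurable_fun_cvg _ _ _ _ (fun n x => f (grid_floor n x))).
  by move=> n; apply: measurable_funTS; exact: measurable_comp_grid_floor.
move=> x cx; apply/cvgrPdist_lt => e e0; have [r r0 rf] := cf x cx e e0.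
near=> n; apply: rf; first exact: grid_floor_cube.
move=> i; rewrite (le_lt_trans (grid_floor_dist _ _ _))//.
by near: n; exact: near_infty_natSinv_lt (PosNum r0).
Unshelve. all: by end_near. Qed.

(** * Open boxes have positive mass: from almost everywhere to everywhere *)

Lemma measurable_open_box {R : realType} {d} (a b : 'I_d -> R) :
  measurable [set x : Rvec R d | forall i, [set` `]a i, b i[%R] (tnth x i)].
Proof.
by apply: (@measurable_box R d (fun i => [set` `]a i, b i[])) => i;
  exact: measurable_itv.
Qed.

(** Induction on [d]: the preimage of a box under [tcons] is its first side times a box of one
    dimension less. In dimension 0 the box contains the atom of the Dirac measure. *)
Lemma lebesgue_box_gt0 {R : realType} {d} (a b : 'I_d -> R) :
  (forall i, a i < b i) ->
  (0 < lebesgue d [set x | forall i, [set` `]a i, b i[%R] (tnth x i)])%E.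
Proof.
elim: d a b => [|n IH] a b ab.
  by rewrite /= diracE mem_set// => -[].
rewrite /= /lebesgue_cons /pushforward.
rewrite (_ : _ @^-1` _ = [set` `]a ord0, b ord0[] `*`
    [set x : Rvec R n | forall i : 'I_n,
      [set` `]a (lift ord0 i), b (lift ord0 i)[] (tnth x i)]); last first.
  apply/seteqP; split => -[y z] /=.
    move=> h; split; first by have := h ord0; rewrite tnth0.
    by move=> i; have := h (lift ord0 i); rewrite tnthS.
  by move=> [h0 h1] i; case: (unliftP ord0 i) => [j ->|->]; rewrite ?tnthS ?tnth0//.
rewrite product_measure1E; [|exact: measurable_itv|
  exact: (measurable_open_box (fun i => a (lift ord0 i)))].
apply: mule_gt0; last exact: IH.
have /= := lebesgue_measure_itv `]a ord0, b ord0[ => ->.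
by rewrite lte_fin ab -EFinD lte_fin subr_gt0.
Qed.

(** A box in the cube has [P]-mass at least inf p times its volume, hence positive mass, and cannot
    lie in the exceptional null set. *)
Lemma ae_cube_dense {R : realType} {d} (P : probability (Rvec R d) R)
    (p : Rvec R d -> R) (Q : Rvec R d -> Prop) :
  has_density P p -> (0 < ereal_inf [set (p x)%:E | x in cube R d])%E ->
  {ae P, forall x, cube R d x -> Q x} ->
  forall x, cube R d x -> forall r, 0 < r ->
  exists y, [/\ cube R d y, forall i, `|tnth x i - tnth y i| < r & Q y].
Proof.
move=> [mp Pp] p0 [N [mN PN QN]] x cx r r0; apply: contrapT => noy.
have infle y : cube R d y -> (ereal_inf [set (p x)%:E | x in cube R d] <= (p y)%:E)%E.
  by move=> cy; apply: ereal_inf_lbound; exists y.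
have fin : ereal_inf [set (p x)%:E | x in cube R d] \is a fin_num.
  by rewrite gt0_fin_numE// (le_lt_trans (infle x cx))// ltry.
(* Truncation at 0 and 1 keeps the box inside the cube, and it stays nonempty even when [x] lies on
   the boundary. *)
pose a i := Num.max 0 (tnth x i - r); pose b i := Num.min 1 (tnth x i + r).
pose B := [set y : Rvec R d | forall i, [set` `]a i, b i[%R] (tnth y i)].
have mB : measurable B by exact: measurable_open_box.
have Bc : B `<=` cube R d.
  move=> y By i; have := By i; rewrite /= in_itv/= gt_max lt_min.
  by move=> /andP[/andP[/ltW -> _] /andP[/ltW -> _]].
have BN : B `<=` N.
  move=> y By; apply: QN => /= Qy; apply: noy; exists y.
  split; [exact: Bc| |exact/Qy/Bc].
  move=> i; have := By i; rewrite /= in_itv/= gt_max lt_min.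
  by move=> /andP[/andP[_ h1] /andP[_ h2]]; rewrite ltr_norml; apply/andP; split; lra.
have ab i : a i < b i.
  have /andP[x0 x1] := cx i.
  by rewrite gt_max !lt_min; apply/andP; split; apply/andP; split; lra.
have PB : P B = 0%E.
  by apply/eqP; rewrite eq_le measure_ge0 andbT -PN le_measure ?inE.
(* The density formula would equate 0 with the integral of [p] over [B], which is positive. *)
have := Pp B mB; rewrite PB setIidl//; apply/eqP; rewrite lt_eqF//.
pose m := fine (ereal_inf [set (p x)%:E | x in cube R d]).
have m0 : 0 < m by rewrite -lte_fin fineK.
apply: (@lt_le_trans _ _ (\int[lebesgue d]_(x in B) (m%:E))%E).
  by rewrite integral_cst// mule_gt0//; exact: lebesgue_box_gt0.
apply: ge0_le_integral => //.
- by move=> y _; rewrite lee_fin ltW.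
- by apply/measurable_EFinP; apply: measurable_funS mp => //; exact: measurable_cube.
- by move=> y By; rewrite /m fineK// infle//; exact: Bc.
Qed.

(** The points where the bound holds are dense by [ae_cube_dense], and continuity of [g] carries it
    to all others. *)
Lemma ae_norm_le_cube {R : realType} {d} (P : probability (Rvec R d) R)
    (p : Rvec R d -> R) (g : Rvec R d -> R) (C : R) :
  has_density P p -> (0 < ereal_inf [set (p x)%:E | x in cube R d])%E ->
  continuous_on_cube g -> {ae P, forall x, cube R d x -> `|g x| <= C} ->
  forall x, cube R d x -> `|g x| <= C.
Proof.
move=> hp p0 /continuous_on_cubeP cg gC x cx; apply/ler_addgt0Pr => e e0.
have [r r0 rg] := cg x cx e e0.
have [y [cy xy gy]] := ae_cube_dense _ _ _ hp p0 gC x cx r r0.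
have := rg y cy xy; rewrite -[g x](subrK (g y)) => xye.
by rewrite (le_trans (ler_normD _ _))// addrC lerD// ltW// -[g x](subrK (g y)).
Qed.

(** * Orthonormal expansions in L^2 *)

(** [P] has total mass 1, so the integral of |h|^2 is at most C^2. *)
Lemma Lnorm2_le {dT} {T : measurableType dT} {R : realType} (P : probability T R)
    (h : T -> R) (C : R) : measurable_fun setT h -> (forall x, `|h x| <= C) ->
  ('N[P]_2%:E [EFin \o h] <= C%:E)%E.
Proof.
move=> mh hC; have C0 : 0 <= C by apply: le_trans (hC point).
rewrite unlock /Lnorm.
have -> : C%:E = ((C ^+ 2)%:E `^ 2^-1)%E.
  by rewrite poweR_EFin powR12_sqrt ?sqr_ge0// sqrtr_sqr ger0_norm.
have I0 : (0 <= \int[P]_x (`|(EFin \o h) x| `^ 2))%E.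
  by apply: integral_ge0 => x _; exact: poweR_ge0.
apply: gt0_ler_poweR; rewrite ?invr_ge0// ?in_itv/= ?leey ?andbT// ?lee_fin ?sqr_ge0//.
have -> : (C ^+ 2)%:E = (\int[P]_x ((C ^+ 2)%:E))%E.
  by rewrite integral_cst//= probability_setT mule1.
apply: ge0_le_integral => //=.
  apply/measurable_EFinP; apply: (measurableT_comp (measurable_powR _)) => //.
  exact: measurableT_comp.
by move=> x _; rewrite lee_fin powR_mulrn// ler_pXn2r ?nnegrE.
Qed.

Lemma bounded_Lfun2 {dT} {T : measurableType dT} {R : realType} (P : probability T R)
    (h : T -> R) (C : R) : measurable_fun setT h -> (forall x, `|h x| <= C) ->
  h \in Lfun P 2%:E.
Proof.
move=> mh hC; rewrite inE; apply/andP; split; rewrite inE//=.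
by rewrite /finite_norm (le_lt_trans (Lnorm2_le _ _ _ mh hC))// ltry.
Qed.

Lemma Lnorm2E {dT} {T : measurableType dT} {R : realType}
    (mu : {measure set T -> \bar R}) (h : T -> R) :
  h \in Lfun mu 2%:E ->
  ('N[mu]_2%:E [EFin \o h] = (Num.sqrt (\int[mu]_x (h x ^+ 2)))%:E)%E.
Proof.
move=> /Lfun2_integrable_sqr hi; rewrite unlock /Lnorm.
under eq_integral do rewrite /= powR_mulrn// real_normK ?num_real//.
rewrite -[X in (X `^ _)%E]fineK; last exact: integrable_fin_num.
rewrite poweR_EFin powR12_sqrt// fine_ge0// integral_ge0// => x _.
by rewrite lee_fin sqr_ge0.
Qed.

Section orthonormal.
Context {dT} {T : measurableType dT} {R : realType}.
Variables (mu : {measure set T -> \bar R}) (e : nat -> T -> R) (c : nat -> R).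
Hypothesis eL2 : forall l, (0 < l)%N -> e l \in Lfun mu 2%:E.
Hypothesis e_orthonormal : forall l m, (0 < l)%N -> (0 < m)%N ->
  \int[mu]_x (e l x * e m x) = (l == m)%:R.

Let S n x := \sum_(1 <= l < n.+1) c l * e l x.

(** The shape [a *: f + g] fits both the closure property of [Lfun] and [integral_linear]. *)
Let S_rec n : S n.+1 = (c n.+1 *: e n.+1 + S n)%R.
Proof. by apply/funext => x; rewrite /S big_nat_recr//= addrC. Qed.

Lemma Lfun2_sum n : S n \in Lfun mu 2%:E.
Proof.
have [L0 LD] := @Lfun_submod_closed _ _ R mu 2%:E (lee1n 2).
elim: n => [|n IH].
  rewrite (_ : S 0 = 0)//; apply/funext => x; rewrite /S big_geq//.
by rewrite S_rec; apply: LD => //; exact: eL2.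
Qed.

Let Rintegral_cst0 : \int[mu]_(_ in [set: T]) (0 : R) = 0.
Proof. by rewrite /Rintegral integral0. Qed.

Let integrableM f g : f \in Lfun mu 2%:E -> g \in Lfun mu 2%:E ->
  mu.-integrable setT (EFin \o (fun x => f x * g x)).
Proof. by move=> fL gL; apply/Lfun1_integrable; exact: Lfun2_mul_Lfun1. Qed.

Let integral_linear a f g h :
  f \in Lfun mu 2%:E -> g \in Lfun mu 2%:E -> h \in Lfun mu 2%:E ->
  \int[mu]_x ((a *: f + g) x * h x) =
  a * (\int[mu]_x (f x * h x)) + \int[mu]_x (g x * h x).
Proof.
move=> fL gL hL.
rewrite (@eq_Rintegral _ _ _ _ _ (fun x => a * (f x * h x) + g x * h x)); last first.
  by move=> x _; rewrite -[(a *: f + g) x]/(a * f x + g x) mulrDl mulrA.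
rewrite RintegralD//.
- by rewrite RintegralZl//; exact: integrableM.
- rewrite (_ : _ \o _ = (fun x => a%:E * (f x * h x)%:E)%E)//.
  by apply: integrableZl => //; exact: integrableM.
- exact: integrableM.
Qed.

Let integral_sum_orthonormal n k : (0 < k)%N ->
  \int[mu]_x (S n x * e k x) = if (k <= n)%N then c k else 0.
Proof.
move=> k0; elim: n => [|n IH].
  rewrite (@eq_Rintegral _ _ _ _ _ (fun=> 0)) ?Rintegral_cst0.
    by rewrite leqn0 gtn_eqF.
  by move=> x _; rewrite /S big_geq// mul0r.
rewrite S_rec integral_linear ?eL2 ?Lfun2_sum// IH e_orthonormal//.
rewrite [(k <= n.+1)%N]leq_eqVlt ltnS eq_sym.
by case: eqVneq => [->|]; rewrite ?ltnn ?mulr1 ?addr0 ?mulr0 ?add0r.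
Qed.

(** Induction, expanding one factor of the square at a time by linearity, so that only integrals of
    [S n] against a single [e k] occur. *)
Lemma integral_sqr_orthonormal n :
  \int[mu]_x (S n x ^+ 2) = \sum_(1 <= l < n.+1) c l ^+ 2.
Proof.
elim: n => [|n IH].
  rewrite (@eq_Rintegral _ _ _ _ _ (fun=> 0)) ?Rintegral_cst0 ?big_geq//.
  by move=> x _; rewrite /S big_geq// expr0n.
rewrite big_nat_recr//= -IH.
have SL := Lfun2_sum.
transitivity (\int[mu]_x ((c n.+1 *: e n.+1 + S n) x * S n.+1 x)).
  by apply: eq_Rintegral => x _; rewrite expr2 S_rec.
rewrite integral_linear ?eL2//.
under [X in c _ * X]eq_Rintegral do rewrite mulrC.
rewrite integral_sum_orthonormal// leqnn -expr2 addrC; congr (_ + _).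
(* Expanding the remaining factor leaves the cross term of [S n] with [e n.+1], which vanishes. *)
under eq_Rintegral do rewrite mulrC S_rec.
rewrite integral_linear ?eL2//.
under [X in c _ * X]eq_Rintegral do rewrite mulrC.
by rewrite integral_sum_orthonormal// ltnn mulr0 add0r.
Qed.

End orthonormal.

Lemma cvge0_near_le {R : realType} (u : nat -> \bar R) (e : R) :
  u @ \oo --> 0%E -> 0 < e -> \forall n \near \oo, (u n <= e%:E)%E.
Proof.
move=> u0 e0; apply: (u0 [set y | (y <= e%:E)%E]).
apply: (filterS (P := [set r | r <= e] : set R)); first by move=> r /=; rewrite lee_fin.
apply/nbhs_ballP; exists e => //= r; rewrite /ball/= sub0r normrN => re.
by rewrite (le_trans (ler_norm _))// ltW.
Qed.

Lemma restrictB {R : realType} {T : Type} (D : set T) (u v : T -> R) :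
  (fun x => u x - v x) \_ D = (u \_ D \- v \_ D)%R.
Proof. by apply/funext => x; rewrite /patch/=; case: ifPn; rewrite ?subr0. Qed.

Lemma restrict_sum {R : realType} {T : Type} (D : set T) (c : nat -> R)
    (phi : nat -> T -> R) n :
  (fun x => \sum_(1 <= l < n.+1) c l * phi l x) \_ D =
  (fun x => \sum_(1 <= l < n.+1) c l * (phi l \_ D) x).
Proof.
apply/funext => x; rewrite /patch; case: ifPn => // _.
by rewrite big1// => l _; rewrite mulr0.
Qed.

(** The cube contains the origin. The bound [C] must also cover the value 0 that restricted
    functions take off the cube. *)
Lemma cube_bound_ge0 {R : realType} {d} (h : Rvec R d -> R) (C : R) :
  (forall x, cube R d x -> `|h x| <= C) -> 0 <= C.
Proof.
move=> hC; apply: (le_trans _ (hC [tuple 0 | _ < d] _)) => // i.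
by rewrite tnth_mktuple lexx ler01.
Qed.

Lemma restrict_cube_le {R : realType} {d} (h : Rvec R d -> R) (C : R) :
  (forall x, cube R d x -> `|h x| <= C) ->
  forall x, `|(h \_ (cube R d)) x| <= C.
Proof.
move=> hC x; rewrite /patch; case: ifPn => [/set_mem/hC//|_].
by rewrite normr0; exact: cube_bound_ge0 hC.
Qed.

Lemma continuous_inL2 {R : realType} {d} (P : probability (Rvec R d) R)
    (h : Rvec R d -> R) (C : R) : continuous_on_cube h ->
  (forall x, cube R d x -> `|h x| <= C) -> inL2 P h.
Proof.
move=> ch hC; apply: (@bounded_Lfun2 _ _ _ _ _ C).
  exact: measurable_continuous_on_cube.
exact: restrict_cube_le.
Qed.

(** * Bessel's inequality and identification of the uniform limit *)

Section expansion.
Context {R : realType} {d : nat}.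
Variables (P : probability (Rvec R d) R) (phi : nat -> Rvec R d -> R).
Variables (f : Rvec R d -> R) (c : nat -> R).
Hypothesis phi_L2 : forall l, (0 < l)%N -> inL2 P (phi l).
Hypothesis phi_orthonormal : forall l m, (0 < l)%N -> (0 < m)%N ->
  L2inner P (phi l) (phi m) = (l == m)%:R.
Hypothesis fL2 : inL2 P f.
Hypothesis f_expansion : L2_expansion P phi c f.

Let S n x := \sum_(1 <= l < n.+1) c l * phi l x.

Let S_L2 n : inL2 P (S n).
Proof. by rewrite /inL2 restrict_sum; exact: Lfun2_sum. Qed.

Let measurable_inL2 h : inL2 P h -> measurable_fun setT (h \_ (cube R d)).
Proof. by move=> /(@sub_Lfun_mfun _ _ _ _ _ _); rewrite inE. Qed.

Let L2norm_le_sum (u v w : Rvec R d -> R) :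
  inL2 P u -> inL2 P v -> (u =1 v \+ w)%R -> inL2 P w ->
  (L2norm P u <= L2norm P v + L2norm P w)%E.
Proof.
move=> uL vL uvw wL; rewrite /L2norm.
have -> : u \_ (cube R d) = (v \_ (cube R d) \+ w \_ (cube R d))%R.
  by apply/funext => x; rewrite /patch/=; case: ifPn => _; rewrite ?uvw ?addr0.
by apply: eminkowski; [exact: measurable_inL2|exact: measurable_inL2|rewrite lee1n].
Qed.

Let inL2B u v : inL2 P u -> inL2 P v -> inL2 P (fun x => u x - v x).
Proof.
move=> uL vL; rewrite /inL2 restrictB.
have [_ LD] := @Lfun_submod_closed _ _ R P 2%:E (lee1n 2).
have := LD (- 1) _ _ vL uL; rewrite scaleN1r addrC; exact.
Qed.

Let L2norm_distC u v : L2norm P (fun x => u x - v x) = L2norm P (fun x => v x - u x).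
Proof.
rewrite /L2norm -oppe_Lnorm; congr Lnorm; apply/funext => x.
by rewrite /= !restrictB /= opprB.
Qed.

Let L2norm_fin : L2norm P f \is a fin_num.
Proof. by rewrite /L2norm Lnorm2E. Qed.

Lemma L2norm_partial_sum n :
  L2norm P (S n) = (Num.sqrt (\sum_(1 <= l < n.+1) c l ^+ 2))%:E.
Proof.
have := S_L2 n; rewrite /L2norm /inL2 restrict_sum => SL; rewrite Lnorm2E//.
congr (Num.sqrt _)%:E; apply: integral_sqr_orthonormal => // l m l0 m0.
rewrite -phi_orthonormal// /L2inner [RHS]Rintegral_mkcond; apply: eq_Rintegral => x _.
by rewrite /patch; case: ifPn; rewrite ?mul0r.
Qed.

(** The norm of [S n] is at most that of any later partial sum, and these converge to [f] in L^2, so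
    the triangle inequality suffices. *)
Lemma bessel n : \sum_(1 <= l < n.+1) c l ^+ 2 <= fine (L2norm P f) ^+ 2.
Proof.
have s0 m : 0 <= \sum_(1 <= l < m.+1) c l ^+ 2.
  by rewrite sumr_ge0// => l _; exact: sqr_ge0.
have F0 : 0 <= fine (L2norm P f) by rewrite fine_ge0// Lnorm_ge0.
suff le_n : Num.sqrt (\sum_(1 <= l < n.+1) c l ^+ 2) <= fine (L2norm P f).
  by rewrite -[leLHS]sqr_sqrtr// ler_pXn2r ?nnegrE ?sqrtr_ge0.
apply/ler_addgt0Pr => e e0.
have [N _ /(_ (maxn N n) (leq_maxl _ _)) hN] := cvge0_near_le _ _ f_expansion e0.
apply: (@le_trans _ _ (Num.sqrt (\sum_(1 <= l < (maxn N n).+1) c l ^+ 2))).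
  rewrite ler_wsqrtr// [leRHS](@big_cat_nat _ _ _ n.+1)//= ?ltnS ?leq_maxr//.
  by rewrite lerDl sumr_ge0// => l _; exact: sqr_ge0.
rewrite -lee_fin -L2norm_partial_sum EFinD fineK//.
apply: le_trans (leeD (lexx _) hN); rewrite L2norm_distC.
have SL := S_L2 (maxn N n).
by apply: L2norm_le_sum => //; [move=> x /=; rewrite addrC subrK|exact: inL2B].
Qed.

(** Uniform convergence implies L^2 convergence for a probability, so [S n] tends in L^2 to both [g]
    and [f], and their difference has norm 0. *)
Lemma uniform_limit_ae_eq (g : Rvec R d -> R) (t : nat -> R) :
  continuous_on_cube g -> inL2 P g -> t @ \oo --> 0 ->
  (forall n x, cube R d x -> `|g x - S n x| <= t n) ->
  {ae P, forall x, cube R d x -> g x = f x}.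
Proof.
move=> cg gL t0 gt.
have SL := S_L2.
have gfL : inL2 P (fun x => g x - f x) by exact: inL2B.
have N0 : L2norm P (fun x => g x - f x) = 0%E.
  apply/eqP; rewrite eq_le Lnorm_ge0 andbT; apply/lee_addgt0Pr => e e0.
  rewrite add0e; have e2 : 0 < e / 2 by rewrite divr_gt0.
  have [N _ hN] := cvge0_near_le _ _ f_expansion e2.
  have /cvgr0Pnorm_lt/(_ _ e2)[M _ hM] := t0.
  pose n := maxn N M.
  have nN := hN n (leq_maxl _ _); have nM := hM n (leq_maxr _ _).
  have gS : (L2norm P (fun x => g x - S n x)%R <= (e / 2)%:E)%E.
    apply: Lnorm2_le; first exact: (measurable_inL2 _ (inL2B _ _ gL (SL n))).
    apply: restrict_cube_le => x cx; apply: (le_trans (gt n x cx)).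
    by rewrite ltW// (le_lt_trans (ler_norm _)).
  apply: (@le_trans _ _ (L2norm P (fun x => g x - S n x)%R +
      L2norm P (fun x => S n x - f x)%R)%E).
    apply: L2norm_le_sum; [by []|exact: inL2B| |exact: inL2B].
    by move=> x /=; rewrite [RHS]addrA subrK.
  by rewrite (splitr e) EFinD leeD// L2norm_distC.
have mgf : measurable_fun setT (EFin \o ((fun x => g x - f x) \_ (cube R d))).
  by apply/measurable_EFinP; exact: measurable_inL2.
have := Lnorm_eq0_eq0 mgf _ N0; rewrite lte_fin ltr0n => /(_ isT).
apply: filterS => x /= /(_ I) + cx.
by rewrite /patch mem_set//= => -[/eqP]; rewrite subr_eq0 => /eqP.
Qed.

End expansion.

(** * Uniform convergence of the expansion and the final bound *)

Lemma weierstrass_M {R : realType} {T : Type} (D : set T) (u : nat -> T -> R)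
    (M : nat -> R) (C : R) :
  (forall l x, (0 < l)%N -> D x -> `|u l x| <= M l) ->
  (forall n, \sum_(1 <= l < n.+1) M l <= C) ->
  (forall l, (0 < l)%N -> 0 <= M l) ->
  exists g t, [/\ t @ \oo --> (0 : R),
    forall n x, D x -> `|g x - \sum_(1 <= l < n.+1) u l x| <= t n &
    forall x, D x -> `|g x| <= C].
Proof.
move=> uM MC M0; pose S n x := \sum_(1 <= l < n.+1) u l x.
pose A n := \sum_(1 <= l < n.+1) M l.
have split (v : nat -> R) n m : (n <= m)%N -> \sum_(1 <= l < m.+1) v l =
    \sum_(1 <= l < n.+1) v l + \sum_(n.+1 <= l < m.+1) v l.
  by move=> nm; rewrite -big_cat_nat.
have ndA : {homo A : n m / (n <= m)%N >-> n <= m}.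
  move=> n m nm; rewrite /A (split _ _ _ nm) lerDl big_nat sumr_ge0// => l.
  by move=> /andP[nl _]; rewrite M0// (leq_trans _ nl).
have cvA : cvgn A.
  by apply: nondecreasing_is_cvgn => //; exists C => _ [n _ <-]; exact: MC.
have SA n m x : (n <= m)%N -> D x -> `|S m x - S n x| <= A m - A n.
  move=> nm Dx; rewrite /S /A !(split _ _ _ nm) !(addrC (\sum_(1 <= _ < _) _)) !addrK.
  rewrite (le_trans (ler_norm_sum _ _ _))// !big_nat ler_sum// => l /andP[nl _].
  by rewrite uM// (leq_trans _ nl).
have cvS x : D x -> cvgn (S ^~ x).
  move=> Dx; have shift (v : nat -> R) :
      (fun n => \sum_(1 <= l < n.+1) v l) = series (fun l => v l.+1).
    by apply/funext => n; rewrite big_add1.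
  rewrite /S shift; apply: normed_cvg.
  apply: (@series_le_cvg _ _ (fun l => M l.+1)) => //=.
  - by move=> l; exact: M0.
  - by move=> l; exact: uM.
  - by rewrite -shift.
(* The rate is the tail of the majorant series; both estimates pass to the limit from partial
   sums. *)
exists (fun x => limn (S ^~ x)), (fun n => limn A - A n); split.
- by rewrite -(subrr (limn A)); apply: cvgB => //; exact: cvg_cst.
- move=> n x Dx; have lS : `|S m x - S n x| @[m --> \oo] --> `|limn (S ^~ x) - S n x|.
    by apply: cvg_norm; apply: cvgB; [exact: cvS|exact: cvg_cst].
  apply: (cvgr_to_le lS); near=> m.
  have nm : (n <= m)%N by near: m; exact: nbhs_infty_ge.
  by rewrite (le_trans (SA _ _ _ nm Dx))// lerB// nondecreasing_cvgn_le.
- move=> x Dx; have lS : `|S m x| @[m --> \oo] --> `|limn (S ^~ x)|.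
    by apply: cvg_norm; exact: cvS.
  apply: (cvgr_to_le lS); near=> m; rewrite (le_trans _ (MC m))//.
  rewrite (le_trans (ler_norm_sum _ _ _))// !big_nat ler_sum// => l /andP[l0 _].
  by rewrite uM.
Unshelve. all: by end_near. Qed.

Theorem theorem4p2 (R : realType) (d : nat) (hd : (0 < d)%N)
    (sigma : R) (hsigma : 0 < sigma)
    (P : probability (Rvec R d) R) (p : Rvec R d -> R)
    (hp : has_density P p)
    (hp_inf : (0 < ereal_inf [set (p x)%:E | x in cube R d])%E)
    (hp_sup : (ereal_sup [set (p x)%:E | x in cube R d] < +oo)%E)
    (mu : nat -> R) (phi : nat -> Rvec R d -> R)
    (hphi : mercer_decomposition (gaussian_kernel sigma) P p mu phi)
    (b : R) (hb : 0 < b)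
    (hphib : forall l : nat, (0 < l)%N ->
      (uniform_norm (phi l) <= (b * l%:R ^+ 2)%:E)%E)
    (s : R) (hs : 3 < s)
    (f : Rvec R d -> R) (hf : inL2 P f)
    (c : nat -> R) (hfc : L2_expansion P phi c f)
    (hsnorm : (snorm2 s c < +oo)%E) :
  (exists g : Rvec R d -> R, continuous_representative P f g) /\
  (forall g : Rvec R d -> R, continuous_representative P f g ->
    (uniform_norm g <=
      (pi / Num.sqrt 6 * b * snorm s c `^ (3 / s)
        * fine (L2norm P f) `^ (1 - 3 / s))%:E)%E).
Proof.
have phile l x : (0 < l)%N -> cube R d x -> `|phi l x| <= b * l%:R ^+ 2.
  move=> l0 cx; rewrite -lee_fin (le_trans _ (hphib l l0))//.
  by apply: ereal_sup_ubound; exists x.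
have [phic phio _ _ _] := hphi.
have phiL l : (0 < l)%N -> inL2 P (phi l).
  by move=> l0; apply: continuous_inL2 (phic l l0) _ => x; exact: phile.
pose t := 3 / s; pose F := fine (L2norm P f).
have F0 : 0 <= F by rewrite fine_ge0// Lnorm_ge0.
(* Finiteness of [snorm2 s c] ensures that [fine] returns the sum itself, not its default value 0 at
   infinity. *)
have sA n : \sum_(1 <= l < n.+1) c l ^+ 2 / l%:R `^ (- 2 * s) <= fine (snorm2 s c).
  have ge0 l : (0 <= (c l ^+ 2 / l%:R `^ (- 2 * s))%:E)%E.
    by rewrite lee_fin divr_ge0 ?sqr_ge0 ?powR_ge0.
  have fin : snorm2 s c \is a fin_num.
    by rewrite ge0_fin_numE// nneseries_ge0.
  rewrite -lee_fin fineK// -sumEFin.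
  by apply: nneseries_lim_ge => l _ _.
pose C := pi / Num.sqrt 6 * b * snorm s c `^ t * F `^ (1 - t).
(* The claimed bound [C] dominates the partial sums of the majorants b |c_l| l^2, so the M-test
   yields it for the limit as well. *)
have MC n : \sum_(1 <= l < n.+1) b * (`|c l| * l%:R ^+ 2) <= C.
  rewrite -mulr_sumr (_ : C = b * (pi / Num.sqrt 6 * snorm s c `^ t * F `^ (1 - t))).
    rewrite ler_wpM2l ?(ltW hb)//.
    apply: (sum_norm_coef_sqr_le s (fine (snorm2 s c)) F c n) => //.
    exact: (bessel P phi).
  by rewrite /C mulrA; congr (_ * _); rewrite mulrA; congr (_ * _); rewrite mulrC.
have M0 l : (0 < l)%N -> 0 <= b * (`|c l| * l%:R ^+ 2).
  by move=> _; rewrite !mulr_ge0// ltW.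
have uM l x : (0 < l)%N -> cube R d x -> `|c l * phi l x| <= b * (`|c l| * l%:R ^+ 2).
  by move=> l0 cx; rewrite normrM mulrCA ler_wpM2l// phile.
have [g [e [e0 ge gC]]] := weierstrass_M _ _ _ _ uM MC M0.
have cg : continuous_on_cube g.
  apply: (continuous_on_cube_uniform_limit _ _ _ _ e0 ge) => n.
  exact: continuous_on_cube_series.
have gf : {ae P, forall x, cube R d x -> g x = f x}.
  have gL : inL2 P g by exact: (continuous_inL2 P g C).
  exact: (uniform_limit_ae_eq P phi f c phiL hf hfc g e cg gL e0 ge).
split; first by exists g.
move=> g' [cg' g'f]; apply: ge_ereal_sup => _ [x cx <-]; rewrite lee_fin.
(* [g'] agrees almost everywhere on the cube with [g], which [C] bounds there; so the bound for [g']
   is only needed almost everywhere. *)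
apply: ae_norm_le_cube hp hp_inf cg' _ x cx.
apply: filterS2 gf g'f => x gx g'x cx.
by rewrite g'x// -gx// gC.
Qed.
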